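(* Let $\mathbb{C}$ be a path category and let $u : \dot{\mathcal{U}} \to \mathcal{U}$ be a fibration in $\mathbb{C}$. Suppose that a $\mathcal{U}$-small object $A$ is $\mathcal{U}$-homogeneous. Let $m : A \to B$ be a cofibration and let $s : B \to A$ be any map. Then $m$ is a monomorphism.
   Context: A path category (Van den Berg–Moerdijk) is a category $\mathbb{C}$ with two classes of morphisms, fibrations and weak equivalences (a trivial fibration is a map that is both), such that: (1) fibrations are closed under composition; (2) the pullback of a fibration along any map exists and is a fibration; (3) the pullback of a trivial fibration along any map is a trivial fibration; (4) weak equivalences satisfy 2-out-of-6: for $f : A \to B$, $g : B \to C$, $h : C \to D$, if $g\circ f$ and $h \circ g$ are weak equivalences then so are $f$, $g$, $h$ and $h\circ g\circ f$; (5) every isomorphism is a trivial fibration; (6) every trivial fibration has a section; (7) $\mathbb{C}$ has a terminal object $1$ and every map $B \to 1$ is a fibration; (8) for every object $B$ the diagonal $B \to B \times B$ factors as $B \xrightarrow{r} PB \xrightarrow{p} B \times B$ with $r$ a weak equivalence and $p$ a fibration. Such a factorisation is called a path object on $B$; write $p_0 = \pi_0 \circ p$, $p_1 = \pi_1\circ p$. Two maps $f, g : X \to Y$ are homotopic, $f \sim g$, if there is a map $H : X \to PY$ with $p_0 \circ H = f$ and $p_1 \circ H = g$ (this is independent of the choice of path object on $Y$). A cofibration is a map with the left lifting property against all trivial fibrations. An object $A$ is $\mathcal{U}$-small if $A \to 1$ is a pullback of $u : \dot{\mathcal{U}} \to \mathcal{U}$ along some map $1 \to \mathcal{U}$. Fixing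 such a pullback square, $\iota_A : A \to \dot{\mathcal{U}}$ denotes its top map (it is a monomorphism, being a pullback of a monomorphism). The $\mathcal{U}$-small object $A$ (with $\iota_A$) is $\mathcal{U}$-homogeneous if $\iota_A \circ \pi_0 \sim \iota_A \circ \pi_1 : A \times A \to \dot{\mathcal{U}}$, where $\pi_0,\pi_1 : A \times A \to A$ are the projections. *)

(* Defs.v *)
Set Implicit Arguments.
Unset Strict Implicit.
Unset Printing Implicit Defensive.

Record Category : Type := {
  Ob :> Type;
  Hom : Ob -> Ob -> Type;
  idm : forall A : Ob, Hom A A;
  comp : forall A B C : Ob, Hom B C -> Hom A B -> Hom A C;
  comp_idl : forall (A B : Ob) (f : Hom A B), comp (idm B) f = f;
  comp_idr : forall (A B : Ob) (f : Hom A B), comp f (idm A) = f;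
  comp_assoc : forall (A B C D : Ob) (f : Hom A B) (g : Hom B C) (h : Hom C D),
      comp h (comp g f) = comp (comp h g) f
}.

Arguments Hom {c} _ _.
Arguments idm {c} A.

Notation "g ∘ f" := (comp g f) (at level 40, left associativity).

Definition is_iso (C : Category) (A B : C) (f : Hom A B) : Prop :=
  exists g : Hom B A, g ∘ f = idm A /\ f ∘ g = idm B.

Definition is_mono (C : Category) (A B : C) (f : Hom A B) : Prop :=
  forall (X : C) (x y : Hom X A), f ∘ x = f ∘ y -> x = y.

Definition is_terminal (C : Category) (T : C) : Prop :=
  forall X : C, exists t : Hom X T, forall t' : Hom X T, t' = t.

(* The square with legs [q1 : P -> A], [q2 : P -> B] over the cospan
   [f : A -> D], [g : B -> D]. *)
Definition is_pullback (C : Category) (P A B D : C)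
    (q1 : Hom P A) (q2 : Hom P B) (f : Hom A D) (g : Hom B D) : Prop :=
  f ∘ q1 = g ∘ q2 /\
  forall (X : C) (x : Hom X A) (y : Hom X B), f ∘ x = g ∘ y ->
    exists! h : Hom X P, q1 ∘ h = x /\ q2 ∘ h = y.

Record Product (C : Category) (A B : C) : Type := {
  prod_ob :> C;
  pr0 : Hom prod_ob A;
  pr1 : Hom prod_ob B;
  prod_univ : forall (X : C) (x : Hom X A) (y : Hom X B),
      exists! h : Hom X prod_ob, pr0 ∘ h = x /\ pr1 ∘ h = y
}.

Arguments pr0 {C A B} p.
Arguments pr1 {C A B} p.

Definition is_diagonal (C : Category) (B : C) (BB : Product B B)
    (d : Hom B BB) : Prop :=
  pr0 BB ∘ d = idm B /\ pr1 BB ∘ d = idm B.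

Record FibWeqCategory : Type := {
  fw_cat :> Category;
  fib : forall A B : fw_cat, Hom A B -> Prop;
  weq : forall A B : fw_cat, Hom A B -> Prop
}.

Definition triv_fib (C : FibWeqCategory) (A B : C) (f : Hom A B) : Prop :=
  fib f /\ weq f.

Record PathObject (C : FibWeqCategory) (B : C) (BB : Product B B) : Type := {
  path_ob :> C;
  path_r : Hom B path_ob;
  path_p : Hom path_ob BB;
  path_r_weq : weq path_r;
  path_p_fib : fib path_p;
  path_diag : is_diagonal (path_p ∘ path_r)
}.

Definition path_p0 (C : FibWeqCategory) (B : C) (BB : Product B B)
  (P : PathObject BB) : Hom P B := pr0 BB ∘ path_p P.

Definition path_p1 (C : FibWeqCategory) (B : C) (BB : Product B B)
  (P : PathObject BB) : Hom P B := pr1 BB ∘ path_p P.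

Record PathCategory : Type := {
  pc_fw :> FibWeqCategory;
  fib_comp : forall (A B D : pc_fw) (f : Hom A B) (g : Hom B D),
      fib f -> fib g -> fib (g ∘ f);
  fib_pb_exists : forall (A B D : pc_fw) (p : Hom A D) (g : Hom B D),
      fib p ->
      exists (P : pc_fw) (q1 : Hom P A) (q2 : Hom P B), is_pullback q1 q2 p g;
  fib_pb : forall (P A B D : pc_fw)
      (q1 : Hom P A) (q2 : Hom P B) (p : Hom A D) (g : Hom B D),
      is_pullback q1 q2 p g -> fib p -> fib q2;
  triv_fib_pb : forall (P A B D : pc_fw)
      (q1 : Hom P A) (q2 : Hom P B) (p : Hom A D) (g : Hom B D),
      is_pullback q1 q2 p g -> triv_fib p -> triv_fib q2;
  weq_2of6 : forall (A B D E : pc_fw) (f : Hom A B) (g : Hom B D) (h : Hom D E),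
      weq (g ∘ f) -> weq (h ∘ g) ->
      weq f /\ weq g /\ weq h /\ weq (h ∘ (g ∘ f));
  iso_triv_fib : forall (A B : pc_fw) (f : Hom A B), is_iso f -> triv_fib f;
  triv_fib_section : forall (A B : pc_fw) (f : Hom A B), triv_fib f ->
      exists s : Hom B A, f ∘ s = idm B;
  one : pc_fw;
  one_terminal : is_terminal one;
  fib_to_one : forall (B : pc_fw) (t : Hom B one), fib t;
  path_object_exists : forall (B : pc_fw) (BB : Product B B),
      inhabited (PathObject BB)
}.

Arguments one {C} : rename.

(* The relation does not depend on the product or on the path object, so both
   are quantified existentially. *)
Definition homotopic (C : PathCategory) (X Y : C) (f g : Hom X Y) : Prop :=
  exists (YY : Product Y Y) (P : PathObject YY) (H : Hom X P),
    path_p0 P ∘ H = f /\ path_p1 P ∘ H = g.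

Definition cofibration (C : PathCategory) (A B : C) (m : Hom A B) : Prop :=
  forall (X Y : C) (t : Hom X Y), triv_fib t ->
  forall (a : Hom A X) (b : Hom B Y), t ∘ a = b ∘ m ->
    exists d : Hom B X, d ∘ m = a /\ t ∘ d = b.

(* [A] is small for [u] when this type is inhabited; an inhabitant is a fixed
   choice of pullback square exhibiting [A -> 1] as a pullback of [u]. *)
Record Small (C : PathCategory) (Udot U : C) (u : Hom Udot U) (A : C) : Type := {
  small_name : Hom one U;
  small_incl : Hom A Udot;
  small_to_one : Hom A one;
  small_pb : is_pullback small_incl small_to_one u small_name
}.

Definition homogeneous (C : PathCategory) (Udot U : C) (u : Hom Udot U) (A : C)
    (SA : Small u A) : Prop :=
  exists AA : Product A A,
    homotopic (small_incl SA ∘ pr0 AA) (small_incl SA ∘ pr1 AA).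

(* Main.v *)
Require Import Defs.

(** The inclusion [i : A -> Udot] of a small object is a monomorphism, so it is
    enough to extend [i] along [m]: if [e ∘ m = i] then [m] is mono because [i]
    is ([extension_mono]).  The map [i ∘ s : B -> Udot] is such an extension up
    to homotopy: restricting the homogeneity homotopy along
    [(s ∘ m, id) : A -> A x A] gives a homotopy from [i ∘ s ∘ m] to [i].  Since
    the source projection of a path object is a trivial fibration
    ([path_p0_triv_fib]), cofibrations have the homotopy extension property
    ([cofibration_homotopy_extension]), which replaces [i ∘ s] by a homotopic map
    restricting to [i] on the nose. *)

Lemma terminal_unique (C : Category) (T : C) (hT : is_terminal T)
  (X : C) (f g : Hom X T) : f = g.
Proof.
  destruct (hT X) as [t ht]. now rewrite (ht f), (ht g).
Qed.

Lemma pullback_point_mono (C : Category) (T : C) (hT : is_terminal T)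
  (P A D : C) (q1 : Hom P A) (q2 : Hom P T) (f : Hom A D) (g : Hom T D)
  (hP : is_pullback q1 q2 f g) : is_mono q1.
Proof.
  intros X x y e.
  destruct hP as [sq univ].
  destruct (univ X (q1 ∘ y) (q2 ∘ y)) as [h [_ uniq]].
  { now rewrite !comp_assoc, sq. }
  transitivity h.
  - symmetry. apply uniq. split; [exact e | apply terminal_unique, hT].
  - now apply uniq.
Qed.

Lemma extension_mono (C : Category) (A B D : C) (m : Hom A B) (e : Hom B D)
  (h : is_mono (e ∘ m)) : is_mono m.
Proof.
  intros X x y exy. apply h. now rewrite <- !comp_assoc, exy.
Qed.

Section PathCategory.

Context (C : PathCategory).

(** A binary product is a pullback over the terminal object, so its projections
    are pullbacks of maps to [one]. *)
Lemma pr0_fib (A B : C) (AB : Product A B) : fib (pr0 AB).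
Proof.
  destruct (@one_terminal C A) as [tA _], (@one_terminal C B) as [tB _].
  apply fib_pb with (q1 := pr1 AB) (p := tB) (g := tA); [split |].
  - apply terminal_unique, one_terminal.
  - intros X x y _.
    destruct (prod_univ AB y x) as [h [[h0 h1] uniq]].
    exists h. split; [now split |].
    intros h' [h1' h0']. apply uniq. now split.
  - apply fib_to_one.
Qed.

Lemma weq_id (A : C) : weq (idm A).
Proof.
  apply (@iso_triv_fib C). exists (idm A). now rewrite comp_idl.
Qed.

Lemma path_p0_triv_fib (Y : C) (YY : Product Y Y) (P : PathObject YY) :
  triv_fib (path_p0 P).
Proof.
  split.
  - apply fib_comp; [apply path_p_fib | apply pr0_fib].
  - (* 2-out-of-6 for the maps [id], [r] and [p0], where [p0 ∘ r = id]. *)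
    apply (@weq_2of6 C _ _ _ _ (idm Y) (path_r P) (path_p0 P)).
    + rewrite comp_idr. apply path_r_weq.
    + unfold path_p0. rewrite <- comp_assoc, (proj1 (path_diag P)).
      apply weq_id.
Qed.

(** Homotopy extension, keeping only the endpoint of the extended homotopy. *)
Lemma cofibration_homotopy_extension (A B Y : C) (m : Hom A B)
  (hm : cofibration m) (f : Hom B Y) (g : Hom A Y)
  (hfg : homotopic (f ∘ m) g) : exists e : Hom B Y, e ∘ m = g.
Proof.
  destruct hfg as [YY [P [H [H0 H1]]]].
  destruct (hm _ _ _ (path_p0_triv_fib _ _ P) H f H0) as [d [dm _]].
  exists (path_p1 P ∘ d). now rewrite <- comp_assoc, dm.
Qed.

Lemma homotopic_precomp (W X Y : C) (f g : Hom X Y) (k : Hom W X)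
  (hfg : homotopic f g) : homotopic (f ∘ k) (g ∘ k).
Proof.
  destruct hfg as [YY [P [H [H0 H1]]]].
  exists YY, P, (H ∘ k). now rewrite !comp_assoc, H0, H1.
Qed.

(** Any two generalised elements of a homogeneous object become homotopic in
    the total space of [u]. *)
Lemma homogeneous_homotopic (Udot U : C) (u : Hom Udot U) (A : C)
  (SA : Small u A) (hA : homogeneous SA) (X : C) (x y : Hom X A) :
  homotopic (small_incl SA ∘ x) (small_incl SA ∘ y).
Proof.
  destruct hA as [AA h].
  destruct (prod_univ AA x y) as [k [[<- <-] _]].
  rewrite !comp_assoc. now apply homotopic_precomp.
Qed.

End PathCategory.

Theorem theorem5p2 (C : PathCategory) (Udot U : C) (u : Hom Udot U)
  (hu : fib u) (A : C) (SA : Small u A) (hA : homogeneous SA)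
  (B : C) (m : Hom A B) (hm : cofibration m) (s : Hom B A) :
  is_mono m.
Proof.
  pose proof (homogeneous_homotopic _ _ _ _ _ _ hA _ (s ∘ m) (idm A)) as h.
  rewrite comp_assoc, comp_idr in h.
  destruct (cofibration_homotopy_extension _ _ _ _ _ hm _ _ h) as [e he].
  apply extension_mono with (e := e). rewrite he.
  exact (pullback_point_mono _ _ (@one_terminal C) _ _ _ _ _ _ _ (small_pb SA)).
Qed.
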